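(* (Preservation, defined variables.) Let $P$ be a program, let $\Rightarrow$ be the defined-variables augmented execution relation of $P$ and $\rightarrow$ the standard execution relation of $P$. For all labels $l,l'$, states $\sigma,\sigma'$ and sets $\pi,\pi'\subseteq V$: if $\langle l,\sigma,\pi\rangle\Rightarrow\langle l',\sigma',\pi'\rangle$, then $\langle l,\sigma\rangle\rightarrow\langle l',\sigma'\rangle$.
   Context: Language. $N$ is the set of integers, $T=\{\mathbf{true},\mathbf{false}\}$, $V$ a set of variables, $L$ a set of labels. Arithmetic expressions $E$: $e::=n\mid v\mid e_0+e_1\mid e_0-e_1\mid e_0\times e_1$ ($n\in N$, $v\in V$). Boolean expressions $B$: $b::=\mathbf{true}\mid\mathbf{false}\mid e_0=e_1\mid e_0\le e_1\mid\mathbf{not}\,b\mid b_0\,\mathbf{and}\,b_1\mid b_0\,\mathbf{or}\,b_1$. Commands: $c::=\mathbf{skip}\mid v:=e\mid\mathbf{if}\,b\,\mathbf{then}\,g\mid\mathbf{goto}\,g\mid\mathbf{halt}\mid\mathbf{done}$ ($g\in L$). A program $P$ is a sequence of labeled commands $l:c$ with pairwise distinct labels; $\mathbf{next}(l)$ is the label of the command following $l$ in the sequence. If $l:\mathbf{halt}\in P$ then $\mathbf{next}(l):\mathbf{done}\in P$. Branch targets $g$, and $\mathbf{next}(l)$ for each assignment, $\mathbf{skip}$, $\mathbf{if}$ or $\mathbf{halt}$ command at $l$, are labels of $P$. Standard semantics. A state is a partial function $\sigma:V\rightharpoonup N$ with domain $\mathrm{dom}\,\sigma$. The evaluation relations $\langle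 e,\sigma\rangle\rightarrow n$ and $\langle b,\sigma\rangle\rightarrow t$ are the least relations with: constants evaluate to themselves; $\langle v,\sigma\rangle\rightarrow\sigma(v)$ if $v\in\mathrm{dom}\,\sigma$; a compound expression evaluates to the result of applying its operator to the values of all of its immediate subexpressions, provided all of these evaluate (no short-circuiting). The relation $\langle l,\sigma\rangle\rightarrow\langle l',\sigma'\rangle$ is the least relation with: if $l:v:=e\in P$ and $\langle e,\sigma\rangle\rightarrow n$, then $\langle l,\sigma\rangle\rightarrow\langle\mathbf{next}(l),\sigma[v\mapsto n]\rangle$; if $l:\mathbf{if}\,b\,\mathbf{then}\,g\in P$, then $\langle l,\sigma\rangle\rightarrow\langle g,\sigma\rangle$ when $\langle b,\sigma\rangle\rightarrow\mathbf{true}$ and $\langle l,\sigma\rangle\rightarrow\langle\mathbf{next}(l),\sigma\rangle$ when $\langle b,\sigma\rangle\rightarrow\mathbf{false}$; if $l:\mathbf{goto}\,g\in P$, then $\langle l,\sigma\rangle\rightarrow\langle g,\sigma\rangle$; if $l:\mathbf{skip}\in P$, or $l:\mathbf{halt}\in P$ and $\mathbf{next}(l):\mathbf{done}\in P$, then $\langle l,\sigma\rangle\rightarrow\langle\mathbf{next}(l),\sigma\rangle$. Defined-variables augmented semantics. The history variable is a set $\pi\subseteq V$; the lattice of such sets is ordered by reverse inclusion ($\pi'\le\pi''$ iff $\pi'\supseteq\pi''$). Evaluation $\langle e,\sigma,\pi\rangle\Rightarrow n$, $\langle b,\sigma,\pi\rangle\Rightarrow t$ is defined by exactly the standard rules with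 $\pi$ carried along unchanged. The relation $\langle l,\sigma,\pi\rangle\Rightarrow\langle l',\sigma',\pi'\rangle$ is the least relation with: if $l:v:=e\in P$ and $\langle e,\sigma,\pi\rangle\Rightarrow n$, then $\langle l,\sigma,\pi\rangle\Rightarrow\langle\mathbf{next}(l),\sigma[v\mapsto n],\pi\cup\{v\}\rangle$; for $\mathbf{if}$, $\mathbf{goto}$, $\mathbf{skip}$, $\mathbf{halt}$ the rules are the standard ones with evaluation $\Rightarrow$ in place of $\rightarrow$ and $\pi$ passed through unchanged; and (upward closure) if $\langle l,\sigma,\pi\rangle\Rightarrow\langle l',\sigma',\pi'\rangle$ and $\pi'\supseteq\pi''$, then $\langle l,\sigma,\pi\rangle\Rightarrow\langle l',\sigma',\pi''\rangle$. *)

(* Defs.v *)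
From Stdlib Require Import ZArith Bool Ensembles List ClassicalEpsilon.
Import ListNotations.

Set Implicit Arguments.
Unset Strict Implicit.

Section Syntax.
Variables V L : Type.

Inductive aexp : Type :=
| ANum (n : Z)
| AVar (v : V)
| APlus (e0 e1 : aexp)
| AMinus (e0 e1 : aexp)
| ATimes (e0 e1 : aexp).

Inductive bexp : Type :=
| BTrue
| BFalse
| BEq (e0 e1 : aexp)
| BLe (e0 e1 : aexp)
| BNot (b : bexp)
| BAnd (b0 b1 : bexp)
| BOr (b0 b1 : bexp).

Inductive command : Type :=
| CSkip
| CAssign (v : V) (e : aexp)
| CIf (b : bexp) (g : L)
| CGoto (g : L)
| CHalt
| CDone.

Definition is_label (p : list (L * command)) (l : L) : Prop :=
  List.In l (map fst p).

(* [is_next p l l'] is the graph of the partial map [next]: it is single-valued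
   as soon as the labels of [p] are pairwise distinct, and [next l] is
   undefined when [l] labels the last command. *)
Definition is_next (p : list (L * command)) (l l' : L) : Prop :=
  exists p1 c c' p2, p = p1 ++ (l, c) :: (l', c') :: p2.

Definition is_target (c : command) (g : L) : Prop :=
  match c with
  | CIf _ g' | CGoto g' => g = g'
  | _ => False
  end.

Definition falls_through (c : command) : Prop :=
  match c with
  | CSkip | CAssign _ _ | CIf _ _ | CHalt => True
  | CGoto _ | CDone => False
  end.

Record program : Type := Program {
  code :> list (L * command);
  labels_distinct : NoDup (map fst code);
  halt_done : forall l, List.In (l, CHalt) code ->
    exists l', is_next code l l' /\ List.In (l', CDone) code;
  targets_are_labels : forall l c g,
    List.In (l, c) code -> is_target c g -> is_label code g;
  next_is_label : forall l c, List.In (l, c) code -> falls_through c ->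
    exists l', is_next code l l' /\ is_label code l'
}.

End Syntax.

Arguments ANum {V} n.
Arguments BTrue {V}.
Arguments BFalse {V}.
Arguments CSkip {V L}.
Arguments CAssign {V L} v e.
Arguments CIf {V L} b g.
Arguments CGoto {V L} g.
Arguments CHalt {V L}.
Arguments CDone {V L}.

Section Semantics.
Variables V L : Type.

(* A partial function; its domain is the set of [v] with [s v <> None]. *)
Definition state : Type := V -> option Z.

(* Equality on [V] is decided classically, so that [V] can be any set. *)
Definition update (s : state) (v : V) (n : Z) : state :=
  fun w => if excluded_middle_informative (w = v) then Some n else s w.

Inductive aeval : aexp V -> state -> Z -> Prop :=
| aeval_num n s : aeval (ANum n) s n
| aeval_var v s n : s v = Some n -> aeval (AVar v) s n
| aeval_plus e0 e1 s n0 n1 :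
    aeval e0 s n0 -> aeval e1 s n1 -> aeval (APlus e0 e1) s (n0 + n1)%Z
| aeval_minus e0 e1 s n0 n1 :
    aeval e0 s n0 -> aeval e1 s n1 -> aeval (AMinus e0 e1) s (n0 - n1)%Z
| aeval_times e0 e1 s n0 n1 :
    aeval e0 s n0 -> aeval e1 s n1 -> aeval (ATimes e0 e1) s (n0 * n1)%Z.

Inductive beval : bexp V -> state -> bool -> Prop :=
| beval_true s : beval BTrue s true
| beval_false s : beval BFalse s false
| beval_eq e0 e1 s n0 n1 :
    aeval e0 s n0 -> aeval e1 s n1 -> beval (BEq e0 e1) s (n0 =? n1)%Z
| beval_le e0 e1 s n0 n1 :
    aeval e0 s n0 -> aeval e1 s n1 -> beval (BLe e0 e1) s (n0 <=? n1)%Z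
| beval_not b s t : beval b s t -> beval (BNot b) s (negb t)
| beval_and b0 b1 s t0 t1 :
    beval b0 s t0 -> beval b1 s t1 -> beval (BAnd b0 b1) s (t0 && t1)
| beval_or b0 b1 s t0 t1 :
    beval b0 s t0 -> beval b1 s t1 -> beval (BOr b0 b1) s (t0 || t1).

Inductive step (P : program V L) : L * state -> L * state -> Prop :=
| step_assign l l' v e s n :
    List.In (l, CAssign v e) P -> is_next P l l' -> aeval e s n ->
    step P (l, s) (l', update s v n)
| step_if_true l b g s :
    List.In (l, CIf b g) P -> beval b s true ->
    step P (l, s) (g, s)
| step_if_false l l' b g s :
    List.In (l, CIf b g) P -> is_next P l l' -> beval b s false ->
    step P (l, s) (l', s)
| step_goto l g s :
    List.In (l, CGoto g) P ->
    step P (l, s) (g, s)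
| step_skip l l' s :
    List.In (l, CSkip) P -> is_next P l l' ->
    step P (l, s) (l', s)
| step_halt l l' s :
    List.In (l, CHalt) P -> is_next P l l' -> List.In (l', CDone) P ->
    step P (l, s) (l', s).

Definition history : Type := Ensemble V.

(* The lattice order on histories is reverse inclusion. *)
Definition history_le (h h' : history) : Prop := Included V h' h.

Inductive aug_aeval : aexp V -> state -> history -> Z -> Prop :=
| aug_aeval_num n s h : aug_aeval (ANum n) s h n
| aug_aeval_var v s h n : s v = Some n -> aug_aeval (AVar v) s h n
| aug_aeval_plus e0 e1 s h n0 n1 :
    aug_aeval e0 s h n0 -> aug_aeval e1 s h n1 ->
    aug_aeval (APlus e0 e1) s h (n0 + n1)%Z
| aug_aeval_minus e0 e1 s h n0 n1 :
    aug_aeval e0 s h n0 -> aug_aeval e1 s h n1 ->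
    aug_aeval (AMinus e0 e1) s h (n0 - n1)%Z
| aug_aeval_times e0 e1 s h n0 n1 :
    aug_aeval e0 s h n0 -> aug_aeval e1 s h n1 ->
    aug_aeval (ATimes e0 e1) s h (n0 * n1)%Z.

Inductive aug_beval : bexp V -> state -> history -> bool -> Prop :=
| aug_beval_true s h : aug_beval BTrue s h true
| aug_beval_false s h : aug_beval BFalse s h false
| aug_beval_eq e0 e1 s h n0 n1 :
    aug_aeval e0 s h n0 -> aug_aeval e1 s h n1 ->
    aug_beval (BEq e0 e1) s h (n0 =? n1)%Z
| aug_beval_le e0 e1 s h n0 n1 :
    aug_aeval e0 s h n0 -> aug_aeval e1 s h n1 ->
    aug_beval (BLe e0 e1) s h (n0 <=? n1)%Z
| aug_beval_not b s h t :
    aug_beval b s h t -> aug_beval (BNot b) s h (negb t)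
| aug_beval_and b0 b1 s h t0 t1 :
    aug_beval b0 s h t0 -> aug_beval b1 s h t1 ->
    aug_beval (BAnd b0 b1) s h (t0 && t1)
| aug_beval_or b0 b1 s h t0 t1 :
    aug_beval b0 s h t0 -> aug_beval b1 s h t1 ->
    aug_beval (BOr b0 b1) s h (t0 || t1).

Inductive aug_step (P : program V L) :
    L * state * history -> L * state * history -> Prop :=
| aug_step_assign l l' v e s h n :
    List.In (l, CAssign v e) P -> is_next P l l' -> aug_aeval e s h n ->
    aug_step P (l, s, h) (l', update s v n, Union V h (Singleton V v))
| aug_step_if_true l b g s h :
    List.In (l, CIf b g) P -> aug_beval b s h true ->
    aug_step P (l, s, h) (g, s, h)
| aug_step_if_false l l' b g s h :
    List.In (l, CIf b g) P -> is_next P l l' -> aug_beval b s h false ->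
    aug_step P (l, s, h) (l', s, h)
| aug_step_goto l g s h :
    List.In (l, CGoto g) P ->
    aug_step P (l, s, h) (g, s, h)
| aug_step_skip l l' s h :
    List.In (l, CSkip) P -> is_next P l l' ->
    aug_step P (l, s, h) (l', s, h)
| aug_step_halt l l' s h :
    List.In (l, CHalt) P -> is_next P l l' -> List.In (l', CDone) P ->
    aug_step P (l, s, h) (l', s, h)
| aug_step_up l l' s s' h h' h'' :
    aug_step P (l, s, h) (l', s', h') -> history_le h' h'' ->
    aug_step P (l, s, h) (l', s', h'').

End Semantics.

(* Main.v *)
Require Import Defs.

(** Erasing the history turns each augmented rule into its standard counterpart, since evaluation
    never consults [h]; upward closure alters only the history, so after erasure its conclusion is
    its premise. *)

Lemma aeval_of_aug (V : Type) (e : aexp V) (s : state V) (h : history V) n :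
  aug_aeval e s h n -> aeval e s n.
Proof. induction 1; constructor; assumption. Qed.

Lemma beval_of_aug (V : Type) (b : bexp V) (s : state V) (h : history V) t :
  aug_beval b s h t -> beval b s t.
Proof. induction 1; constructor; eauto using aeval_of_aug. Qed.

(** Whole configurations [x] and [y], with [fst] erasing the history, keep the indices of [aug_step]
    variables, so that plain induction loses no information. *)
Lemma step_of_aug (V L : Type) (P : program V L) (x y : L * state V * history V) :
  aug_step P x y -> step P (fst x) (fst y).
Proof.
  induction 1; simpl in *;
    eauto using step, aeval_of_aug, beval_of_aug.
Qed.

Theorem theorem5p2 (V L : Type) (P : program V L) (l l' : L)
    (s s' : state V) (h h' : history V) :
  aug_step P (l, s, h) (l', s', h') -> step P (l, s) (l', s').
Proof. exact (step_of_aug V L P (l, s, h) (l', s', h')). Qed.
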